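(* Consider the $\beta$-plane problem with centripetal forces (system (E), incompressibility (M), boundary conditions (B1)–(B3) as set out in the context). Assume that the vorticity vector $\mathbf{\Upsilon}=(\Upsilon_1,\Upsilon_2,\Upsilon_3)$ is constant and satisfies $\Upsilon_2+\hat f\neq0$. Then the only bounded solution $(u,v,w,P,\eta)$ of (E), (M), (B1), (B2), (B3) is the one with flat surface $\eta\equiv\eta_0$, and with velocity field and pressure given by $$(u,v,w)=\Big(-\frac{\hat f^2}{4\beta},\,0,\,0\Big),$$ $$P(x,y,z,t)=\rho\Big[-\frac{\hat f^3}{4\beta}+\frac{\hat f^2}{4}R-g\Big](z-\eta_0)+P_{atm},$$ where $\eta_0$ is a constant.
   Context: Constants: $\Omega>0$ (rotational speed of the Earth), $R>0$ (radius of the Earth), $g>0$ (gravitational acceleration), $\rho>0$ (constant water density), $P_{atm}$ (constant atmospheric pressure), $d>0$ (the flat bed is $z=-d$), $c>0$ (wave speed), $L>0$ (wave period). The latitude $\phi\in(-\pi/2,\pi/2)$ is fixed, and $f=2\Omega\sin\phi$, $\hat f=2\Omega\cos\phi\neq0$, $\beta=\hat f/R$ are constants. Free surface and fluid domain: the free surface is $z=\eta(x-ct)$, where $\eta$ is an $L$-periodic function of one real variable with $\eta>-d$ and zero mean $\int_0^L\eta(s)\,ds=0$ (so the constant height $\eta_0$ of a flat surface is subject to this normalization). The surface is flat if $\eta$ is constant. The surface does not depend on $y$. The fluid domain at time $t$ is $\{(x,y,z): x,y\in\mathbb{R},\ -d\le z\le \eta(x-ct)\}$. The velocity field $\mathbf{u}=(u,v,w)$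 and the pressure $P$ are functions of $(x,y,z,t)$, sufficiently smooth (classical) in the fluid domain up to its boundary. (E) ($\beta$-plane equations with centripetal terms): $$u_t+uu_x+vu_y+wu_z+\hat f w-(f+\beta y)v=-\tfrac1\rho P_x,$$ $$v_t+uv_x+vv_y+wv_z+(f+\beta y)u+\tfrac{\hat f^2}{4}y+\tfrac{\hat f f}{4}R=-\tfrac1\rho P_y,$$ $$w_t+uw_x+vw_y+ww_z-\hat f u-\tfrac{\hat f^2}{4}R=-\tfrac1\rho P_z-g.$$ (M) (incompressibility): $u_x+v_y+w_z=0$. (B1) $P=P_{atm}$ on $z=\eta(x-ct)$. (B2) $w=(u-c)\eta_x$ on $z=\eta(x-ct)$. (B3) $w=0$ on $z=-d$. The vorticity vector is $\mathbf{\Upsilon}=(\Upsilon_1,\Upsilon_2,\Upsilon_3)=(w_y-v_z,\ u_z-w_x,\ v_x-u_y)$; ''constant'' means that it does not depend on $(x,y,z,t)$. A solution is called bounded if its velocity field $(u,v,w)$ is bounded on the fluid domain. *)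

(* Defs.v *)
From Stdlib Require Import Reals Lra.
From Coquelicot Require Import Coquelicot.
Open Scope R_scope.

Record params := Params {
  Omega : R;   (* rotational speed of the Earth *)
  radius : R;  (* radius of the Earth *)
  grav : R;    (* gravitational acceleration *)
  rho : R;     (* water density *)
  Patm : R;    (* atmospheric pressure *)
  depth : R;   (* the flat bed is z = - depth *)
  speed : R;   (* wave speed c *)
  period : R;  (* wave period L *)
  phi : R      (* latitude *)
}.

Definition admissible_params (p : params) : Prop :=
  0 < Omega p /\ 0 < radius p /\ 0 < grav p /\ 0 < rho p /\
  0 < depth p /\ 0 < speed p /\ 0 < period p /\
  - (PI / 2) < phi p < PI / 2.

Definition cor_f (p : params) : R := 2 * Omega p * sin (phi p).
Definition cor_fhat (p : params) : R := 2 * Omega p * cos (phi p).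
Definition cor_beta (p : params) : R := cor_fhat p / radius p.

(* Scalar fields and space-time regions, in the variables x, y, z, t.  Fields
   are total; only their values on the fluid domain are ever constrained. *)
Definition field := R -> R -> R -> R -> R.
Definition region := R -> R -> R -> R -> Prop.

Definition uncurry4 {A : Type} (f : R -> R -> R -> R -> A)
  (q : R * R * R * R) : A :=
  let '(x, y, z, t) := q in f x y z t.

Definition Dx (f : field) : field := fun x y z t => Derive (fun s => f s y z t) x.
Definition Dy (f : field) : field := fun x y z t => Derive (fun s => f x s z t) y.
Definition Dz (f : field) : field := fun x y z t => Derive (fun s => f x y s t) z.
Definition Dt (f : field) : field := fun x y z t => Derive (fun s => f x y z s) t.

Definition fluid_domain (p : params) (eta : R -> R) : region :=
  fun x y z t => - depth p <= z <= eta (x - speed p * t).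

(* For continuous [eta] this is the interior of [fluid_domain p eta]. *)
Definition fluid_interior (p : params) (eta : R -> R) : region :=
  fun x y z t => - depth p < z < eta (x - speed p * t).

(* [C_upto n U D f]: [f] is of class C^n in the open region [U], and [f] and
   all its partial derivatives of order at most [n] extend continuously to the
   closed region [D] (for [f] itself, by its own values on [D]).  The witnesses
   [fx], [fy], [fz], [ft] are the partial derivatives, extended to [D]. *)
Fixpoint C_upto (n : nat) (U D : region) (f : field) : Prop :=
  continuous_on (uncurry4 D) (uncurry4 f) /\
  match n with
  | O => True
  | S m =>
      exists fx fy fz ft : field,
        (C_upto m U D fx /\ C_upto m U D fy /\
         C_upto m U D fz /\ C_upto m U D ft) /\
        forall x y z t, U x y z t ->
          is_derive (fun s => f s y z t) x (fx x y z t) /\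
          is_derive (fun s => f x s z t) y (fy x y z t) /\
          is_derive (fun s => f x y s t) z (fz x y z t) /\
          is_derive (fun s => f x y z s) t (ft x y z t)
  end.

Definition surface_profile (p : params) (eta : R -> R) : Prop :=
  (forall s, ex_derive eta s /\ continuous (Derive eta) s) /\
  (forall s, eta (s + period p) = eta s) /\
  (forall s, - depth p < eta s) /\
  RInt eta 0 (period p) = 0.

(* The regularity under which the equations and their curl make classical
   sense: velocity of class C^2, pressure of class C^1. *)
Definition smooth_flow (p : params) (u v w P : field) (eta : R -> R) : Prop :=
  let U := fluid_interior p eta in
  let D := fluid_domain p eta in
  C_upto 2 U D u /\ C_upto 2 U D v /\ C_upto 2 U D w /\ C_upto 1 U D P.

(* The differential equations below are imposed in the interior, where the
   two-sided derivatives are meaningful; for smooth flows this is equivalent to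
   imposing them up to the boundary. *)

Definition momentum (p : params) (u v w P : field) (eta : R -> R) : Prop :=
  let f := cor_f p in let fh := cor_fhat p in let b := cor_beta p in
  forall x y z t, fluid_interior p eta x y z t ->
    let U := u x y z t in let V := v x y z t in let W := w x y z t in
    Dt u x y z t + U * Dx u x y z t + V * Dy u x y z t + W * Dz u x y z t
      + fh * W - (f + b * y) * V
    = - (1 / rho p) * Dx P x y z t
    /\
    Dt v x y z t + U * Dx v x y z t + V * Dy v x y z t + W * Dz v x y z t
      + (f + b * y) * U + fh ^ 2 / 4 * y + fh * f / 4 * radius p
    = - (1 / rho p) * Dy P x y z t
    /\
    Dt w x y z t + U * Dx w x y z t + V * Dy w x y z t + W * Dz w x y z t
      - fh * U - fh ^ 2 / 4 * radius p
    = - (1 / rho p) * Dz P x y z t - grav p.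

Definition incompressible (p : params) (u v w : field) (eta : R -> R) : Prop :=
  forall x y z t, fluid_interior p eta x y z t ->
    Dx u x y z t + Dy v x y z t + Dz w x y z t = 0.

Definition surface_dynamic (p : params) (P : field) (eta : R -> R) : Prop :=
  forall x y t, P x y (eta (x - speed p * t)) t = Patm p.

Definition surface_kinematic (p : params) (u w : field) (eta : R -> R) : Prop :=
  forall x y t,
    let s := x - speed p * t in
    w x y (eta s) t = (u x y (eta s) t - speed p) * Derive eta s.

Definition bed_kinematic (p : params) (w : field) : Prop :=
  forall x y t, w x y (- depth p) t = 0.

Definition solution (p : params) (u v w P : field) (eta : R -> R) : Prop :=
  surface_profile p eta /\
  smooth_flow p u v w P eta /\
  momentum p u v w P eta /\
  incompressible p u v w eta /\
  surface_dynamic p P eta /\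
  surface_kinematic p u w eta /\
  bed_kinematic p w.

Definition bounded_velocity (p : params) (u v w : field) (eta : R -> R) : Prop :=
  exists M : R, forall x y z t, fluid_domain p eta x y z t ->
    Rabs (u x y z t) <= M /\ Rabs (v x y z t) <= M /\ Rabs (w x y z t) <= M.

Definition constant_vorticity (p : params) (u v w : field) (eta : R -> R)
  (Y1 Y2 Y3 : R) : Prop :=
  forall x y z t, fluid_interior p eta x y z t ->
    Dy w x y z t - Dz v x y z t = Y1 /\
    Dz u x y z t - Dx w x y z t = Y2 /\
    Dx v x y z t - Dy u x y z t = Y3.

Definition flat_u (p : params) : field :=
  fun x y z t => - (cor_fhat p ^ 2 / (4 * cor_beta p)).
Definition flat_v : field := fun x y z t => 0.
Definition flat_w : field := fun x y z t => 0.
Definition flat_P (p : params) (eta0 : R) : field :=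
  fun x y z t =>
    rho p * (- (cor_fhat p ^ 3 / (4 * cor_beta p))
             + cor_fhat p ^ 2 / 4 * radius p - grav p) * (z - eta0) + Patm p.

(* Main.v *)
(* The curl of the momentum equations says that the absolute vorticity
   (Y1, Y2 + fh, Y3 + f + beta y) satisfies L u = L v = 0 and L w = beta v, where
   L is the derivative along it.  Since L does not commute with D_y, applying L
   to the constant vorticity components gives v_x = u_z = 0 and v_y = w_z, whence
   u_y = - Y3, u_x = - 2 v_y and u_xx = 0.  On a horizontal plane lying between
   the bed and the surface, u is therefore affine along x-lines, so boundedness
   kills u_x, and likewise u_y; hence w_z = 0, and the bed condition gives w = 0,
   so v = 0 and u is a function of t alone.  The pressure is then quadratic in y
   with coefficients independent of z, and its constancy on the surface fixes the
   value of u.  As u < 0 < c, the kinematic condition flattens the surface. *)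
Require Import Defs.
From Stdlib Require Import Reals Lra.
From Coquelicot Require Import Coquelicot.
Open Scope R_scope.

(** * Partial derivatives on space-time and the symmetry of second derivatives *)

(** [Schwarz] speaks of [Derive], whereas here the derivatives are given by witnesses. The two agree
    on a neighbourhood, so local extensionality transfers both the nested derivatives and their
    continuity. *)
Lemma mixed_derivatives_eq (F F1 F2 F12 F21 : R -> R -> R) (x y : R) :
  locally_2d (fun a b =>
    is_derive (fun s => F s b) a (F1 a b) /\
    is_derive (fun s => F a s) b (F2 a b) /\
    is_derive (fun s => F1 a s) b (F12 a b) /\
    is_derive (fun s => F2 s b) a (F21 a b)) x y ->
  continuity_2d_pt F12 x y -> continuity_2d_pt F21 x y ->
  F12 x y = F21 x y.
Proof.
intros HP C12 C21.
assert (HD : locally_2d (fun a b =>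
    is_derive (fun s => F s b) a (F1 a b) /\
    is_derive (fun s => F a s) b (F2 a b) /\
    is_derive (fun s => Derive (fun t => F t s) a) b (F12 a b) /\
    is_derive (fun s => Derive (fun t => F s t) b) a (F21 a b)) x y).
{ revert HP. apply locally_2d_impl_strong, locally_2d_forall.
  intros a b HP. destruct (locally_2d_singleton _ _ _ HP) as (H1 & H2 & H12 & H21).
  refine (conj H1 (conj H2 (conj _ _))).
  - refine (is_derive_ext_loc _ _ _ _ _ H12).
    apply locally_2d_1d_const_x in HP. revert HP; apply filter_imp.
    intros s (K & _). symmetry; apply is_derive_unique, K.
  - refine (is_derive_ext_loc _ _ _ _ _ H21).
    apply locally_2d_1d_const_y in HP. revert HP; apply filter_imp.
    intros s (_ & K & _). symmetry; apply is_derive_unique, K. }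
destruct (locally_2d_singleton _ _ _ HD) as (_ & _ & K12 & K21).
rewrite <- (is_derive_unique _ _ _ K12), <- (is_derive_unique _ _ _ K21).
symmetry; apply Schwarz.
- revert HD; apply locally_2d_impl, locally_2d_forall.
  intros a b (H1 & H2 & H12 & H21); repeat split; eexists; eauto.
- apply continuity_2d_pt_ext_loc with F21; [|exact C21].
  revert HD; apply locally_2d_impl, locally_2d_forall.
  intros a b (_ & _ & _ & H); symmetry; apply is_derive_unique, H.
- apply continuity_2d_pt_ext_loc with F12; [|exact C12].
  revert HD; apply locally_2d_impl, locally_2d_forall.
  intros a b (_ & _ & H & _); symmetry; apply is_derive_unique, H.
Qed.

Definition point : Type := R * R * R * R.

Inductive axis := AX | AY | AZ | AT.

Definition coord (i : axis) (q : point) : R :=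
  let '(x, y, z, t) := q in
  match i with AX => x | AY => y | AZ => z | AT => t end.

Definition upd (i : axis) (q : point) (s : R) : point :=
  let '(x, y, z, t) := q in
  match i with
  | AX => (s, y, z, t) | AY => (x, s, z, t)
  | AZ => (x, y, s, t) | AT => (x, y, z, s)
  end.

Definition is_pd (i : axis) (f : point -> R) (q : point) (l : R) : Prop :=
  is_derive (fun s => f (upd i q s)) (coord i q) l.

Lemma upd_coord (i : axis) (q : point) : upd i q (coord i q) = q.
Proof. now destruct q as [[[x y] z] t], i. Qed.

Lemma continuous_pair {T A B : UniformSpace} (f : T -> A) (g : T -> B) (x : T) :
  continuous f x -> continuous g x -> continuous (fun t => (f t, g t)) x.
Proof.
intros Hf Hg. apply (continuous_comp_2 f g (fun a b => (a, b))); auto.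
apply continuous_ext with (fun z : A * B => z); [now intros [a b]|].
apply continuous_id.
Qed.

Lemma continuous_fst_comp {T A B : UniformSpace} (f : T -> A * B) (x : T) :
  continuous f x -> continuous (fun t => fst (f t)) x.
Proof.
intros H. apply (continuous_comp f fst); auto.
destruct (f x); apply continuous_fst.
Qed.

Lemma continuous_snd_comp {T A B : UniformSpace} (f : T -> A * B) (x : T) :
  continuous f x -> continuous (fun t => snd (f t)) x.
Proof.
intros H. apply (continuous_comp f snd); auto.
destruct (f x); apply continuous_snd.
Qed.

Lemma continuous_coord (i : axis) (q : point) : continuous (coord i) q.
Proof.
apply (continuous_ext (fun q : point =>
  match i with
  | AX => fst (fst (fst q)) | AY => snd (fst (fst q))
  | AZ => snd (fst q) | AT => snd q
  end)); [now intros [[[a b] c] d]; destruct i|].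
destruct i;
  repeat (apply continuous_fst_comp || apply continuous_snd_comp);
  apply continuous_id.
Qed.

Lemma continuous_upd (T : UniformSpace) (i : axis) (c : T -> point) (s : T -> R) (x : T) :
  continuous c x -> continuous s x -> continuous (fun t => upd i (c t) (s t)) x.
Proof.
intros Hc Hs.
assert (Hk : forall k, continuous (fun t => coord k (c t)) x).
{ intros k. apply (continuous_comp c (coord k)); auto. apply continuous_coord. }
destruct i; [ pose (g := fun t => (s t, coord AY (c t), coord AZ (c t), coord AT (c t)))
 | pose (g := fun t => (coord AX (c t), s t, coord AZ (c t), coord AT (c t)))
 | pose (g := fun t => (coord AX (c t), coord AY (c t), s t, coord AT (c t)))
 | pose (g := fun t => (coord AX (c t), coord AY (c t), coord AZ (c t), s t)) ];
(apply (continuous_ext g); [ intros t; unfold g; now destruct (c t) as [[[? ?] ?] ?] |];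
 unfold g; repeat apply continuous_pair; auto).
Qed.

(** The coordinate line through [q] is a continuous curve, so it stays in the open set [U] near [q];
    only the values there affect the derivative. *)
Lemma is_pd_locally_eq (U : point -> Prop) (i : axis) (f g : point -> R) (q : point) (l : R) :
  open U -> U q -> (forall r, U r -> f r = g r) -> is_pd i f q l -> is_pd i g q l.
Proof.
intros HU Hq H. apply is_derive_ext_loc.
assert (C : continuous (upd i q) (coord i q)).
{ apply continuous_upd; [apply continuous_const | apply continuous_id]. }
specialize (C U). rewrite upd_coord in C. specialize (C (HU q Hq)).
change (locally (coord i q) (fun s => U (upd i q s))) in C.
revert C; apply filter_imp. intros s Hs; apply H, Hs.
Qed.

Lemma is_pd_unique (i : axis) (f : point -> R) (q : point) (l m : R) :
  is_pd i f q l -> is_pd i f q m -> l = m.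
Proof.
intros Hl Hm. now rewrite <- (is_derive_unique _ _ _ Hl), <- (is_derive_unique _ _ _ Hm).
Qed.

Lemma is_pd_const (i : axis) (k : R) (q : point) : is_pd i (fun _ => k) q 0.
Proof. apply (is_derive_const (K := R_AbsRing) (V := R_NormedModule) k). Qed.

Lemma is_pd_coord (i j : axis) (q : point) :
  is_pd i (coord j) q
    match i, j with AX, AX | AY, AY | AZ, AZ | AT, AT => 1 | _, _ => 0 end.
Proof.
destruct q as [[[x y] z] t], i, j; unfold is_pd; simpl;
  first [ apply (is_derive_id (K := R_AbsRing))
        | apply (is_derive_const (K := R_AbsRing) (V := R_NormedModule)) ].
Qed.

Lemma is_pd_plus (i : axis) (f g : point -> R) (q : point) (l m : R) :
  is_pd i f q l -> is_pd i g q m -> is_pd i (fun r => f r + g r) q (l + m).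
Proof. apply (is_derive_plus (K := R_AbsRing) (V := R_NormedModule)). Qed.

Lemma is_pd_minus (i : axis) (f g : point -> R) (q : point) (l m : R) :
  is_pd i f q l -> is_pd i g q m -> is_pd i (fun r => f r - g r) q (l - m).
Proof. apply (is_derive_minus (K := R_AbsRing) (V := R_NormedModule)). Qed.

Lemma is_pd_mult (i : axis) (f g : point -> R) (q : point) (l m : R) :
  is_pd i f q l -> is_pd i g q m -> is_pd i (fun r => f r * g r) q (l * g q + f q * m).
Proof.
intros Hf Hg. generalize (is_derive_mult _ _ _ _ _ Hf Hg Rmult_comm).
now rewrite upd_coord.
Qed.

(** The tool for differentiating an identity that holds throughout an open set: partial derivatives
    of its two sides may be equated. *)
Lemma is_pd_eq (U : point -> Prop) (i : axis) (f g : point -> R) (q : point) (l m : R) :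
  open U -> U q -> (forall r, U r -> f r = g r) ->
  is_pd i f q l -> is_pd i g q m -> l = m.
Proof.
intros HU Hq H Hf Hg. apply (is_pd_unique i g q); auto.
now apply (is_pd_locally_eq U i f g).
Qed.

Lemma continuous_Rmult {T : UniformSpace} (f g : T -> R) (x : T) :
  continuous f x -> continuous g x -> continuous (fun t => f t * g t) x.
Proof. apply (continuous_mult (K := R_AbsRing)). Qed.

Lemma continuous_Rplus {T : UniformSpace} (f g : T -> R) (x : T) :
  continuous f x -> continuous g x -> continuous (fun t => f t + g t) x.
Proof. apply (continuous_plus (V := R_NormedModule)). Qed.

Lemma continuous_Rminus {T : UniformSpace} (f g : T -> R) (x : T) :
  continuous f x -> continuous g x -> continuous (fun t => f t - g t) x.
Proof. apply (continuous_minus (V := R_NormedModule)). Qed.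

(** For distinct axes, restrict to the coordinate plane through [q] that they span and apply the
    two-variable statement. For [i = j] that plane degenerates, but then [fi] and [fj] agree on [U]
    by uniqueness of derivatives. *)
Lemma is_pd_comm (U : point -> Prop) (i j : axis) (f fi fj fij fji : point -> R) (q : point) :
  open U -> U q ->
  (forall r, U r -> is_pd i f r (fi r) /\ is_pd j f r (fj r) /\
                    is_pd j fi r (fij r) /\ is_pd i fj r (fji r)) ->
  continuous fij q -> continuous fji q -> fij q = fji q.
Proof.
intros HU Hq H Cij Cji.
assert (Hd : i = j \/ i <> j) by (destruct i, j; (now left) || (right; discriminate)).
destruct Hd as [<-|Hd].
{ destruct (H q Hq) as (_ & _ & K1 & K2).
  apply (is_pd_eq U i fi fj q); auto.
  intros r Hr. destruct (H r Hr) as (K3 & K4 & _).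
  apply (is_pd_unique _ _ _ _ _ K3 K4). }
(* [e] parametrizes the plane; its continuity pulls [U] back to a neighbourhood and carries over the
   continuity of [fij] and [fji]. *)
pose (e := fun a b => upd j (upd i q a) b).
assert (E0 : e (coord i q) (coord j q) = q).
{ unfold e. rewrite upd_coord. apply upd_coord. }
assert (Ce : forall x y, continuous (fun z : R * R => e (fst z) (snd z)) (x, y)).
{ intros x y. apply continuous_upd; [apply continuous_upd|].
  - apply continuous_const.
  - apply continuous_fst.
  - apply continuous_snd. }
rewrite <- E0.
apply (mixed_derivatives_eq (fun a b => f (e a b)) (fun a b => fi (e a b))
  (fun a b => fj (e a b)) (fun a b => fij (e a b)) (fun a b => fji (e a b))).
- apply locally_2d_locally.
  assert (K := Ce (coord i q) (coord j q) U). simpl in K. rewrite E0 in K.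
  specialize (K (HU q Hq)).
  change (locally (coord i q, coord j q) (fun z : R * R => U (e (fst z) (snd z)))) in K.
  revert K; apply filter_imp.
  intros [a b]; simpl; intros Hab. destruct (H _ Hab) as (H1 & H2 & H3 & H4).
  revert H1 H2 H3 H4. unfold e.
  destruct q as [[[x y] z] t], i, j; try (now contradiction Hd); auto.
- apply continuity_2d_pt_filterlim.
  apply (continuous_comp (fun z : R * R => e (fst z) (snd z)) fij); [apply Ce|].
  simpl; now rewrite E0.
- apply continuity_2d_pt_filterlim.
  apply (continuous_comp (fun z : R * R => e (fst z) (snd z)) fji); [apply Ce|].
  simpl; now rewrite E0.
Qed.

(** Derivatives are carried as explicit functions, so that [solve_pd] and [solve_cont] can work by
    syntax alone. In [h i j] the derivative along [i] is taken first. *)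
Record C2_jet (U : point -> Prop) (f : point -> R)
  (g : axis -> point -> R) (h : axis -> axis -> point -> R) : Prop := {
  jet_cont : forall q, U q -> continuous f q;
  jet_cont1 : forall i q, U q -> continuous (g i) q;
  jet_cont2 : forall i j q, U q -> continuous (h i j) q;
  jet_pd1 : forall i q, U q -> is_pd i f q (g i q);
  jet_pd2 : forall i j q, U q -> is_pd j (g i) q (h i j q)
}.

Lemma jet_sym (U : point -> Prop) (f : point -> R)
  (g : axis -> point -> R) (h : axis -> axis -> point -> R) (i j : axis) (q : point) :
  open U -> C2_jet U f g h -> U q -> h i j q = h j i q.
Proof.
intros HU J Hq. apply (is_pd_comm U i j f (g i) (g j)); auto; try (apply J; auto).
intros r Hr. refine (conj _ (conj _ (conj _ _))); apply J; auto.
Qed.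

(** * The vorticity equations, by cross-differentiation of the pressure gradient *)

Definition kronecker_y (j : axis) : R := match j with AY => 1 | _ => 0 end.

(** The material derivative of a field with first partial derivatives [g]. *)
Definition transport (u v w : point -> R) (g : axis -> point -> R) (q : point) : R :=
  g AT q + u q * g AX q + v q * g AY q + w q * g AZ q.

(** The derivative of [transport] along [j], arranged exactly as the product rule produces it. *)
Definition d_transport (u v w : point -> R) (gu gv gw g : axis -> point -> R)
  (h : axis -> axis -> point -> R) (j : axis) (q : point) : R :=
  h AT j q + (gu j q * g AX q + u q * h AX j q)
  + (gv j q * g AY q + v q * h AY j q) + (gw j q * g AZ q + w q * h AZ j q).

Lemma is_pd_val (i : axis) (f : point -> R) (q : point) (l m : R) :
  is_pd i f q l -> l = m -> is_pd i f q m.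
Proof. now intros H <-. Qed.

(** Builds a derivative from the shape of the expression, with the value that the rules yield; where
    another form is wanted, [is_pd_val] and [ring] convert it. *)
Ltac solve_pd :=
  lazymatch goal with
  | |- is_pd _ (fun r => @?f r + @?g r) _ _ => apply (is_pd_plus _ f g); solve_pd
  | |- is_pd _ (fun r => @?f r - @?g r) _ _ => apply (is_pd_minus _ f g); solve_pd
  | |- is_pd _ (fun r => @?f r * @?g r) _ _ => apply (is_pd_mult _ f g); solve_pd
  | |- is_pd _ (fun _ => ?k) _ _ => apply (is_pd_const _ k)
  | |- is_pd ?i (fun r => ?f r) ?q ?l => change (is_pd i f q l); solve_pd
  | |- is_pd _ (coord ?j) _ _ => apply (is_pd_coord _ j)
  | H : is_pd ?i ?f ?q _ |- is_pd ?i ?f ?q _ => exact H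
  | J : C2_jet _ ?f _ _ |- is_pd _ ?f _ _ => apply (jet_pd1 _ _ _ _ J); assumption
  | J : C2_jet _ _ ?g _ |- is_pd _ (?g _) _ _ => apply (jet_pd2 _ _ _ _ J); assumption
  end.

Ltac solve_cont :=
  lazymatch goal with
  | |- continuous (fun r => @?f r + @?g r) _ => apply (continuous_Rplus f g); solve_cont
  | |- continuous (fun r => @?f r - @?g r) _ => apply (continuous_Rminus f g); solve_cont
  | |- continuous (fun r => @?f r * @?g r) _ => apply (continuous_Rmult f g); solve_cont
  | |- continuous (fun _ => ?k) _ => apply continuous_const
  | |- continuous (fun r => ?f r) ?q => change (continuous f q); solve_cont
  | |- continuous (coord ?j) _ => apply continuous_coord
  | H : continuous ?f ?q |- continuous ?f ?q => exact H
  | J : C2_jet _ ?f _ _ |- continuous ?f _ => apply (jet_cont _ _ _ _ J); assumption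
  | J : C2_jet _ _ ?g _ |- continuous (?g _) _ => apply (jet_cont1 _ _ _ _ J); assumption
  | J : C2_jet _ _ _ ?h |- continuous (?h _ _) _ => apply (jet_cont2 _ _ _ _ J); assumption
  end.

Lemma is_pd_transport (U : point -> Prop) (u v w f : point -> R) (gu gv gw g : axis -> point -> R)
  (hu hv hw h : axis -> axis -> point -> R) (j : axis) (q : point) :
  C2_jet U u gu hu -> C2_jet U v gv hv -> C2_jet U w gw hw -> C2_jet U f g h -> U q ->
  is_pd j (transport u v w g) q (d_transport u v w gu gv gw g h j q).
Proof. intros Ju Jv Jw J Hq. unfold transport, d_transport. solve_pd. Qed.

Lemma continuous_d_transport (U : point -> Prop) (u v w f : point -> R)
  (gu gv gw g : axis -> point -> R)
  (hu hv hw h : axis -> axis -> point -> R) (j : axis) (q : point) :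
  C2_jet U u gu hu -> C2_jet U v gv hv -> C2_jet U w gw hw -> C2_jet U f g h -> U q ->
  continuous (d_transport u v w gu gv gw g h j) q.
Proof. intros Ju Jv Jw J Hq. unfold d_transport. solve_cont. Qed.

(* The momentum equations solved for the pressure gradient: [kx] is minus the
   density, [ky y + ry] is the meridional centripetal term, and [kz] is the
   vertical one minus gravity. *)
Record beta_plane_flow (U : point -> Prop) (f fh b : R) (kx ky kz ry : R)
  (u v w P : point -> R) (gu gv gw gP : axis -> point -> R)
  (hu hv hw : axis -> axis -> point -> R) (Y1 Y2 Y3 : R) : Prop := {
  flow_open : open U;
  flow_u : C2_jet U u gu hu;
  flow_v : C2_jet U v gv hv;
  flow_w : C2_jet U w gw hw;
  flow_P : forall i q, U q -> is_pd i P q (gP i q);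
  flow_x : forall q, U q -> gP AX q =
    kx * (transport u v w gu q + fh * w q - (f + b * coord AY q) * v q);
  flow_y : forall q, U q -> gP AY q =
    kx * (transport u v w gv q + (f + b * coord AY q) * u q + ky * coord AY q + ry);
  flow_z : forall q, U q -> gP AZ q =
    kx * (transport u v w gw q - fh * u q - kz);
  flow_div : forall q, U q -> gu AX q + gv AY q + gw AZ q = 0;
  flow_vort1 : forall q, U q -> gw AY q - gv AZ q = Y1;
  flow_vort2 : forall q, U q -> gu AZ q - gw AX q = Y2;
  flow_vort3 : forall q, U q -> gv AX q - gu AY q = Y3;
}.

(** No second derivatives of [P] are assumed. The momentum equations express its spatial gradient
    through C^1 quantities, so the mixed spatial derivatives exist, are continuous and commute. The
    equations do not give the time derivative of [P]; the value 0 at [AT] is a placeholder. *)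
Lemma pressure_hessian_sym (U : point -> Prop) (f fh b kx ky kz ry : R)
  (u v w P : point -> R) (gu gv gw gP : axis -> point -> R)
  (hu hv hw : axis -> axis -> point -> R) (Y1 Y2 Y3 : R) (i j : axis) (q : point) :
  beta_plane_flow U f fh b kx ky kz ry u v w P gu gv gw gP hu hv hw Y1 Y2 Y3 ->
  U q -> i <> AT -> j <> AT ->
  let hP i j q :=
    match i with
    | AX => kx * (d_transport u v w gu gv gw gu hu j q + fh * gw j q
                  - (b * kronecker_y j * v q + (f + b * coord AY q) * gv j q))
    | AY => kx * (d_transport u v w gu gv gw gv hv j q
                  + (b * kronecker_y j * u q + (f + b * coord AY q) * gu j q) + ky * kronecker_y j)
    | AZ => kx * (d_transport u v w gu gv gw gw hw j q - fh * gu j q)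
    | AT => 0
    end in
  hP i j q = hP j i q.
Proof.
intros [HU Ju Jv Jw HP Hx Hy Hz _ _ _ _] Hq Hi Hj hP.
assert (D : forall i j r, i <> AT -> U r -> is_pd j (gP i) r (hP i j r)).
{ clear i j Hi Hj. intros i j r Hi Hr.
  assert (Tu := is_pd_transport U u v w u gu gv gw gu hu hv hw hu j r Ju Jv Jw Ju Hr).
  assert (Tv := is_pd_transport U u v w v gu gv gw gv hu hv hw hv j r Ju Jv Jw Jv Hr).
  assert (Tw := is_pd_transport U u v w w gu gv gw gw hu hv hw hw j r Ju Jv Jw Jw Hr).
  destruct i; [| | |easy]; unfold hP.
  - eapply is_pd_locally_eq; [exact HU|exact Hr|intros s Hs; symmetry; apply Hx, Hs|].
    eapply is_pd_val; [solve_pd|]. destruct j; simpl; ring.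
  - eapply is_pd_locally_eq; [exact HU|exact Hr|intros s Hs; symmetry; apply Hy, Hs|].
    eapply is_pd_val; [solve_pd|]. destruct j; simpl; ring.
  - eapply is_pd_locally_eq; [exact HU|exact Hr|intros s Hs; symmetry; apply Hz, Hs|].
    eapply is_pd_val; [solve_pd|]. destruct j; simpl; ring. }
assert (C : forall i j, continuous (hP i j) q).
{ clear i j Hi Hj. intros i j.
  assert (Tu := continuous_d_transport U u v w u gu gv gw gu hu hv hw hu j q Ju Jv Jw Ju Hq).
  assert (Tv := continuous_d_transport U u v w v gu gv gw gv hu hv hw hv j q Ju Jv Jw Jv Hq).
  assert (Tw := continuous_d_transport U u v w w gu gv gw gw hu hv hw hw j q Ju Jv Jw Jw Hq).
  destruct i; unfold hP; solve_cont. }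
apply (is_pd_comm U i j P (gP i) (gP j)); auto.
Qed.

(** Differentiates a constant vorticity component along [l]. By symmetry [l] is put first, which is
    the index order of the second derivatives in [d_transport]. *)
Lemma jet_linear_relation (U : point -> Prop) (F G : point -> R) (gF gG : axis -> point -> R)
  (hF hG : axis -> axis -> point -> R) (i j : axis) (k : R) :
  open U -> C2_jet U F gF hF -> C2_jet U G gG hG ->
  (forall q, U q -> gF i q - gG j q = k) ->
  forall l q, U q -> hF l i q = hG l j q.
Proof.
intros HU JF JG H l q Hq.
rewrite (jet_sym U F gF hF l i q), (jet_sym U G gG hG l j q) by assumption.
enough (hF i l q - hG j l q = 0) by lra.
apply (is_pd_eq U l (fun r => gF i r - gG j r) (fun _ => k) q); auto; solve_pd.
Qed.

(** In the curl of the momentum equations, second derivatives of the velocity enter only through the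
    material derivative of the vorticity, which is zero. The stretching terms remain, together with
    [b * v], which comes from differentiating [b * y]. *)
Lemma absolute_vorticity_stretching (U : point -> Prop) (f fh b kx ky kz ry : R)
  (u v w P : point -> R) (gu gv gw gP : axis -> point -> R)
  (hu hv hw : axis -> axis -> point -> R) (Y1 Y2 Y3 : R) (q : point) :
  beta_plane_flow U f fh b kx ky kz ry u v w P gu gv gw gP hu hv hw Y1 Y2 Y3 ->
  kx <> 0 -> U q ->
  Y1 * gu AX q + (Y2 + fh) * gu AY q + (Y3 + f + b * coord AY q) * gu AZ q = 0 /\
  Y1 * gv AX q + (Y2 + fh) * gv AY q + (Y3 + f + b * coord AY q) * gv AZ q = 0 /\
  Y1 * gw AX q + (Y2 + fh) * gw AY q + (Y3 + f + b * coord AY q) * gw AZ q = b * v q.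
Proof.
intros HF Hk Hq.
assert (S := fun i j => pressure_hessian_sym _ _ _ _ _ _ _ _ _ _ _ _ _ _ _ _ _ _ _ _ _ _ i j q HF Hq).
destruct HF as [HU Ju Jv Jw HP Hx Hy Hz Hd H1 H2 H3].
assert (E1 := fun l => jet_linear_relation U w v gw gv hw hv AY AZ Y1 HU Jw Jv H1 l q Hq).
assert (E2 := fun l => jet_linear_relation U u w gu gw hu hw AZ AX Y2 HU Ju Jw H2 l q Hq).
assert (E3 := fun l => jet_linear_relation U v u gv gu hv hu AX AY Y3 HU Jv Ju H3 l q Hq).
assert (Syz := S AY AZ ltac:(discriminate) ltac:(discriminate)).
assert (Sxz := S AX AZ ltac:(discriminate) ltac:(discriminate)).
assert (Sxy := S AX AY ltac:(discriminate) ltac:(discriminate)).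
clear S. cbv beta iota zeta delta [kronecker_y d_transport] in Syz, Sxz, Sxy.
apply Rmult_eq_reg_l in Syz; [|exact Hk].
apply Rmult_eq_reg_l in Sxz; [|exact Hk].
apply Rmult_eq_reg_l in Sxy; [|exact Hk].
(* Now the same second derivatives stand on both sides. Once the constants [Y1], [Y2], [Y3] are
   expanded and [gw AZ q] is eliminated by incompressibility, the claims are linear in the remaining
   monomials. *)
rewrite !E1 in Syz; rewrite !E2 in Sxz; rewrite !E3 in Sxy.
rewrite <- (H1 q Hq), <- (H2 q Hq), <- (H3 q Hq).
specialize (Hd q Hq).
replace (gw AZ q) with (- gu AX q - gv AY q) in * by lra.
repeat split; lra.
Qed.

Lemma rigid_gradients (U : point -> Prop) (f fh b kx ky kz ry : R)
  (u v w P : point -> R) (gu gv gw gP : axis -> point -> R)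
  (hu hv hw : axis -> axis -> point -> R) (Y1 Y2 Y3 : R) (q : point) :
  beta_plane_flow U f fh b kx ky kz ry u v w P gu gv gw gP hu hv hw Y1 Y2 Y3 ->
  kx <> 0 -> b <> 0 -> U q ->
  gv AX q = 0 /\ gu AZ q = 0 /\ gw AZ q = gv AY q.
Proof.
intros HF Hk Hb Hq.
assert (S := fun r => absolute_vorticity_stretching _ _ _ _ _ _ _ _ _ _ _ _ _ _ _ _ _ _ _ _ _ _ r HF Hk).
destruct HF as [HU Ju Jv Jw HP Hx Hy Hz Hd H1 H2 H3].
(* With L := Y1 D_x + (Y2 + fh) D_y + (Y3 + f + b y) D_z one has L u = L v = 0,
   L w = b v and [D_y, L] = b D_z.  Applying L to the three components of the
   constant vorticity then gives b (v_y - w_z) = 0, b v_x = 0 and b u_z = 0. *)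
assert (Lu : forall j, Y1 * hu AX j q + (Y2 + fh) * hu AY j q + b * kronecker_y j * gu AZ q
    + (Y3 + f + b * coord AY q) * hu AZ j q = 0).
{ intros j. eapply (is_pd_eq U j (fun r => Y1 * gu AX r + (Y2 + fh) * gu AY r
    + (Y3 + f + b * coord AY r) * gu AZ r) (fun _ => 0) q); [exact HU|exact Hq|now apply S| |solve_pd].
  eapply is_pd_val; [solve_pd|]. destruct j; simpl; ring. }
assert (Lv : forall j, Y1 * hv AX j q + (Y2 + fh) * hv AY j q + b * kronecker_y j * gv AZ q
    + (Y3 + f + b * coord AY q) * hv AZ j q = 0).
{ intros j. eapply (is_pd_eq U j (fun r => Y1 * gv AX r + (Y2 + fh) * gv AY r
    + (Y3 + f + b * coord AY r) * gv AZ r) (fun _ => 0) q); [exact HU|exact Hq|now apply S| |solve_pd].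
  eapply is_pd_val; [solve_pd|]. destruct j; simpl; ring. }
assert (Lw : forall j, Y1 * hw AX j q + (Y2 + fh) * hw AY j q + b * kronecker_y j * gw AZ q
    + (Y3 + f + b * coord AY q) * hw AZ j q = b * gv j q).
{ intros j. eapply (is_pd_eq U j (fun r => Y1 * gw AX r + (Y2 + fh) * gw AY r
    + (Y3 + f + b * coord AY r) * gw AZ r) (fun r => b * v r) q); [exact HU|exact Hq|now apply S| |].
  - eapply is_pd_val; [solve_pd|]. destruct j; simpl; ring.
  - eapply is_pd_val; [solve_pd|]. ring. }
assert (E1 := fun l => jet_linear_relation U w v gw gv hw hv AY AZ Y1 HU Jw Jv H1 l q Hq).
assert (E2 := fun l => jet_linear_relation U u w gu gw hu hw AZ AX Y2 HU Ju Jw H2 l q Hq).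
assert (E3 := fun l => jet_linear_relation U v u gv gu hv hu AX AY Y3 HU Jv Ju H3 l q Hq).
(* Each vorticity component pairs two identities: [A1] with [A2], [A3] with [A4], [A5] with [A6].
   After the rewrites their second-order parts coincide, and subtraction leaves only terms with the
   factor [b]. *)
assert (A1 := Lw AY); assert (A2 := Lv AZ); assert (A3 := Lu AZ).
assert (A4 := Lw AX); assert (A5 := Lv AX); assert (A6 := Lu AY).
rewrite !E1 in A1; rewrite !E2 in A3; rewrite !E3 in A5.
simpl in A1, A2, A3, A4, A5, A6.
refine (conj _ (conj _ _)); apply (Rmult_eq_reg_l b); auto; lra.
Qed.

(** * Calculus on a line: constant slopes, and passage from open to closed intervals *)

Lemma affine_of_derive (f : R -> R) (k x y : R) :
  (forall s, Rmin x y <= s <= Rmax x y -> is_derive f s k) ->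
  f y = f x + k * (y - x).
Proof.
intros H. destruct (MVT_gen f x y (fun _ => k)) as (c & _ & E); [| |lra].
- intros s Hs. apply H; lra.
- intros s Hs. apply continuity_pt_filterlim.
  apply (ex_derive_continuous (K := R_AbsRing) (V := R_NormedModule)).
  exists k; auto.
Qed.

Lemma bounded_slope_zero (f : R -> R) (k M : R) :
  (forall s, is_derive f s k) -> (forall s, Rabs (f s) <= M) -> k = 0.
Proof.
intros H B. destruct (Req_dec k 0) as [|Hk]; auto.
(* Over the distance [(2 * M + 1) / k] the function grows by [2 * M + 1], more than the bound
   allows. *)
assert (E := affine_of_derive f k 0 ((2 * M + 1) / k) (fun s _ => H s)).
replace (k * ((2 * M + 1) / k - 0)) with (2 * M + 1) in E by (field; auto).
assert (B0 := proj1 (Rabs_le_between _ _) (B 0)).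
assert (B1 := proj1 (Rabs_le_between _ _) (B ((2 * M + 1) / k))).
lra.
Qed.

(** Every point of the closed interval, endpoints included, is a limit point of the open one; this
    makes limits from inside unique. *)
Lemma within_open_interval_proper (a b s : R) :
  a < b -> a <= s <= b -> ProperFilter' (within (fun r => a < r < b) (locally s)).
Proof.
intros Hab Hs. split; [|apply within_filter, locally_filter].
intros [eps He].
(* The test point moves from [s] towards the midpoint by the fraction [th]. Positivity of [th]
   places it inside the open interval; [th * (b - a) <= eps] keeps it close, as the midpoint is at
   distance at most [(b - a) / 2]. *)
pose (th := Rmin (1 / 2) (eps / (b - a))).
assert (T1 : 0 < th).
{ apply Rmin_glb_lt; [lra|]. apply Rdiv_lt_0_compat; [apply cond_pos|lra]. }
assert (T2 : th <= 1 / 2) by apply Rmin_l.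
assert (T3 : th * (b - a) <= eps).
{ apply Rmult_le_reg_r with (/ (b - a)); [apply Rinv_0_lt_compat; lra|].
  rewrite Rmult_assoc, Rinv_r, Rmult_1_r by lra. apply Rmin_r. }
apply (He (s + th * ((a + b) / 2 - s))).
- change (Rabs (s + th * ((a + b) / 2 - s) - s) < eps).
  assert (0 < eps) by apply cond_pos.
  apply Rabs_def1; nra.
- nra.
Qed.

Lemma eq_on_closed_interval (F G : R -> R) (a b : R) :
  a < b -> continuous_on (fun s => a <= s <= b) F ->
  continuous_on (fun s => a <= s <= b) G ->
  (forall s, a < s < b -> F s = G s) -> forall s, a <= s <= b -> F s = G s.
Proof.
intros Hab CF CG E s Hs.
assert (PF := within_open_interval_proper a b s Hab Hs).
apply (filterlim_locally_unique (F := within (fun r => a < r < b) (locally s)) G).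
- apply filterlim_ext_loc with F.
  { unfold within. apply filter_forall; intros r Hr. apply E, Hr. }
  intros Q HQ. specialize (CF s Hs Q HQ).
  unfold filtermap, within in *.
  revert CF; apply filter_imp; intros r Hr Hr'; apply Hr; lra.
- intros Q HQ. specialize (CG s Hs Q HQ).
  unfold filtermap, within in *.
  revert CG; apply filter_imp; intros r Hr Hr'; apply Hr; lra.
Qed.

(** * The fluid domain: verticals, openness of the interior, a horizontal plane inside it *)

Lemma continuous_on_vertical (p : params) (eta : R -> R) (f : field) (x y t : R) :
  continuous_on (uncurry4 (fluid_domain p eta)) (uncurry4 f) ->
  continuous_on (fun z => - depth p <= z <= eta (x - speed p * t)) (fun z => f x y z t).
Proof.
intros C z Hz Q HQ. specialize (C (x, y, z, t) Hz Q HQ).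
assert (K : continuous (fun z : R => (x, y, z, t) : point) z).
{ repeat apply continuous_pair; try apply continuous_const; apply continuous_id. }
apply (K _ C).
Qed.

Lemma profile_continuous (p : params) (eta : R -> R) (s : R) :
  surface_profile p eta -> continuous eta s.
Proof.
intros (H & _). apply (ex_derive_continuous (K := R_AbsRing) (V := R_NormedModule)), H.
Qed.

Lemma open_fluid_interior (p : params) (eta : R -> R) :
  surface_profile p eta -> open (uncurry4 (fluid_interior p eta) : point -> Prop).
Proof.
intros H.
apply (open_ext (fun q : point => - depth p < coord AZ q /\
   0 < eta (coord AX q - speed p * coord AT q) - coord AZ q)).
{ intros [[[x y] z] t]; simpl; unfold fluid_interior; lra. }
apply open_and.
- apply (open_comp (coord AZ) (fun r => - depth p < r)); [|apply open_gt].
  intros q _. exact (continuous_coord AZ q).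
- apply (open_comp (fun q : point => eta (coord AX q - speed p * coord AT q) - coord AZ q)
    (fun r => 0 < r)); [|apply open_gt].
  intros q _.
  apply (continuous_Rminus (fun q : point => eta (coord AX q - speed p * coord AT q)));
    [|apply continuous_coord].
  apply (continuous_comp (fun q => coord AX q - speed p * coord AT q) eta).
  + apply continuous_Rminus; [apply continuous_coord|].
    apply continuous_Rmult; [apply continuous_const|apply continuous_coord].
  + now apply (profile_continuous p).
Qed.

Lemma periodic_IZR (f : R -> R) (L : R) (n : Z) :
  (forall s, f (s + L) = f s) -> forall s, f (s + IZR n * L) = f s.
Proof.
intros H. induction n using Z.peano_ind; intros s.
- f_equal; simpl; ring.
- rewrite succ_IZR, <- (IHn s), <- (H (s + IZR n * L)). f_equal; ring.
- unfold Z.pred; rewrite plus_IZR, <- (IHn s), <- (H (s + (IZR n + -1) * L)). f_equal; ring.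
Qed.

(** A continuous periodic profile attains its minimum, which lies above the bed. The plane at height
    [z0] thus stays in the fluid for all x, y and t, so boundedness can be exploited along entire
    horizontal lines. *)
Lemma level_below_surface (p : params) (eta : R -> R) :
  admissible_params p -> surface_profile p eta ->
  exists z0, - depth p < z0 /\ forall s, z0 < eta s.
Proof.
intros (_ & _ & _ & _ & _ & _ & HL & _) Hp.
destruct (continuity_ab_min eta 0 (period p)) as (m & Hm & _); [lra| |].
{ intros c _. apply continuity_pt_filterlim. now apply (profile_continuous p). }
destruct Hp as (_ & Hper & Hd & _).
exists ((eta m - depth p) / 2). specialize (Hd m). split; [lra|]. intros s.
destruct (floor_ex (s / period p)) as (n & Hn).
enough (eta m <= eta s) by lra.
(* Subtracting [n] periods brings [s] into [[0, period p]], where [m] is the minimizer. *)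
rewrite <- (periodic_IZR eta (period p) (- n) Hper s). apply Hm.
rewrite opp_IZR.
replace (s + - IZR n * period p) with ((s / period p - IZR n) * period p) by (field; lra).
nra.
Qed.

(** * From smooth solutions to jets on the open interior *)

Lemma C_upto_continuous_on (n : nat) (U D : region) (f : field) :
  C_upto n U D f -> continuous_on (uncurry4 D) (uncurry4 f).
Proof. destruct n; intros H; apply H. Qed.

Lemma C_upto_partials (n : nat) (U D : region) (f : field) :
  C_upto (S n) U D f ->
  exists g : axis -> field, (forall i, C_upto n U D (g i)) /\
    forall i q, uncurry4 U q -> is_pd i (uncurry4 f) q (uncurry4 (g i) q).
Proof.
intros (_ & fx & fy & fz & ft & (Hx & Hy & Hz & Ht) & H).
exists (fun i => match i with AX => fx | AY => fy | AZ => fz | AT => ft end).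
split; [now intros []|].
intros i [[[x y] z] t] Hq. destruct (H x y z t Hq) as (Kx & Ky & Kz & Kt).
now destruct i.
Qed.

Lemma C_upto_2_jet (U D : region) (f : field) :
  open (uncurry4 U : point -> Prop) -> (forall q, uncurry4 U q -> uncurry4 D q) ->
  C_upto 2 U D f ->
  exists g h, C2_jet (uncurry4 U) (uncurry4 f) g h.
Proof.
intros HU HUD H.
assert (C : forall n f q, C_upto n U D f -> uncurry4 U q -> continuous (uncurry4 f : point -> R) q).
{ intros n k q Hk Hq. apply continuous_continuous_on with (uncurry4 D : point -> Prop).
  - specialize (HU q Hq). revert HU; apply filter_imp, HUD.
  - now apply C_upto_continuous_on with n U. }
destruct (C_upto_partials 1 U D f H) as (g & Hg & Kg).
destruct (C_upto_partials 0 U D (g AX) (Hg AX)) as (hx & Hx & Kx).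
destruct (C_upto_partials 0 U D (g AY) (Hg AY)) as (hy & Hy & Ky).
destruct (C_upto_partials 0 U D (g AZ) (Hg AZ)) as (hz & Hz & Kz).
destruct (C_upto_partials 0 U D (g AT) (Hg AT)) as (ht & Ht & Kt).
exists (fun i => uncurry4 (g i)), (fun i j => uncurry4
  (match i with AX => hx j | AY => hy j | AZ => hz j | AT => ht j end)).
split.
- intros q Hq. now apply C with 2%nat.
- intros i q Hq. now apply C with 1%nat.
- intros [] j q Hq; now apply C with 0%nat.
- auto.
- intros [] j q Hq; auto.
Qed.

Lemma Derive_partials (f : field) (g : axis -> point -> R) (x y z t : R) :
  (forall i, is_pd i (uncurry4 f) (x, y, z, t) (g i (x, y, z, t))) ->
  Defs.Dx f x y z t = g AX (x, y, z, t) /\ Dy f x y z t = g AY (x, y, z, t) /\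
  Dz f x y z t = g AZ (x, y, z, t) /\ Dt f x y z t = g AT (x, y, z, t).
Proof.
intros H. refine (conj _ (conj _ (conj _ _))); apply is_derive_unique;
  [apply (H AX) | apply (H AY) | apply (H AZ) | apply (H AT)].
Qed.

(** In the interior the derivative witnesses coincide with [Derive]; multiplying the momentum
    equations by [- rho p] then isolates the pressure gradient. *)
Lemma solution_flow (p : params) (u v w P : field) (eta : R -> R) (Y1 Y2 Y3 : R) :
  admissible_params p -> solution p u v w P eta ->
  constant_vorticity p u v w eta Y1 Y2 Y3 ->
  exists gu gv gw gP hu hv hw,
    beta_plane_flow (uncurry4 (fluid_interior p eta)) (cor_f p) (cor_fhat p) (cor_beta p)
      (- rho p) (cor_fhat p ^ 2 / 4) (cor_fhat p ^ 2 / 4 * radius p - grav p)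
      (cor_fhat p * cor_f p / 4 * radius p)
      (uncurry4 u) (uncurry4 v) (uncurry4 w) (uncurry4 P) gu gv gw gP hu hv hw Y1 Y2 Y3.
Proof.
intros (_ & _ & _ & Hrho & _) (Hp & (Su & Sv & Sw & SP) & Hmom & Hinc & _) Hvort.
assert (HU := open_fluid_interior p eta Hp).
assert (HUD : forall q, uncurry4 (fluid_interior p eta) q -> uncurry4 (fluid_domain p eta) q).
{ intros [[[x y] z] t]. simpl. unfold fluid_interior, fluid_domain. lra. }
destruct (C_upto_2_jet _ _ _ HU HUD Su) as (gu & hu & Ju).
destruct (C_upto_2_jet _ _ _ HU HUD Sv) as (gv & hv & Jv).
destruct (C_upto_2_jet _ _ _ HU HUD Sw) as (gw & hw & Jw).
destruct (C_upto_partials _ _ _ _ SP) as (gP & _ & KP).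
exists gu, gv, gw, (fun i => uncurry4 (gP i)), hu, hv, hw.
split; auto; intros [[[x y] z] t] Hq;
  destruct (Derive_partials u gu x y z t) as (ux & uy & uz & ut);
  try (intros i; now apply (jet_pd1 _ _ _ _ Ju));
  destruct (Derive_partials v gv x y z t) as (vx & vy & vz & vt);
  try (intros i; now apply (jet_pd1 _ _ _ _ Jv));
  destruct (Derive_partials w gw x y z t) as (wx & wy & wz & wt);
  try (intros i; now apply (jet_pd1 _ _ _ _ Jw));
  destruct (Derive_partials P (fun i => uncurry4 (gP i)) x y z t) as (Px & Py & Pz & Pt);
  try (intros i; now apply KP);
  destruct (Hmom x y z t Hq) as (Mx & My & Mz);
  specialize (Hinc x y z t Hq);
  destruct (Hvort x y z t Hq) as (V1 & V2 & V3);
  rewrite ?ux, ?uy, ?uz, ?ut, ?vx, ?vy, ?vz, ?vt, ?wx, ?wy, ?wz, ?wt, ?Px, ?Py, ?Pz in *;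
  auto; unfold transport; simpl coord; simpl uncurry4.
- replace (gP AX x y z t) with (- rho p * (- (1 / rho p) * uncurry4 (gP AX) (x, y, z, t)))
    by (simpl; field; lra).
  rewrite <- Mx. ring.
- replace (gP AY x y z t) with (- rho p * (- (1 / rho p) * uncurry4 (gP AY) (x, y, z, t)))
    by (simpl; field; lra).
  rewrite <- My. simpl; field.
- replace (gP AZ x y z t) with (- rho p * (- (1 / rho p) * uncurry4 (gP AZ) (x, y, z, t)))
    by (simpl; field; lra).
  replace (- (1 / rho p) * uncurry4 (gP AZ) (x, y, z, t)) with
    (- (1 / rho p) * uncurry4 (gP AZ) (x, y, z, t) - grav p + grav p) by ring.
  rewrite <- Mz. simpl; field.
Qed.

(** * Vanishing gradients from boundedness *)

Lemma interior_segment (p : params) (eta : R -> R) (x y z1 z2 t s : R) :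
  fluid_interior p eta x y z1 t -> fluid_interior p eta x y z2 t ->
  Rmin z1 z2 <= s <= Rmax z1 z2 -> fluid_interior p eta x y s t.
Proof.
unfold fluid_interior. intros H1 H2 [Hs1 Hs2]. split.
- apply Rlt_le_trans with (2 := Hs1). apply Rmin_glb_lt; lra.
- apply Rle_lt_trans with (1 := Hs2). apply Rmax_lub_lt; lra.
Qed.

(** Boundedness is invoked only on the plane [z0]. What it gives there reaches the other depths
    because [Y3] is a constant and [gu AX] does not vary along verticals. *)
Lemma steady_gradients (p : params) (eta : R -> R) (f fh b kx ky kz ry : R)
  (u v w : field) (P : point -> R) (gu gv gw gP : axis -> point -> R)
  (hu hv hw : axis -> axis -> point -> R) (Y1 Y2 Y3 z0 : R) :
  beta_plane_flow (uncurry4 (fluid_interior p eta)) f fh b kx ky kz ry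
    (uncurry4 u) (uncurry4 v) (uncurry4 w) P gu gv gw gP hu hv hw Y1 Y2 Y3 ->
  kx <> 0 -> b <> 0 -> bounded_velocity p u v w eta ->
  (forall x y t, fluid_interior p eta x y z0 t) ->
  forall x y z t, fluid_interior p eta x y z t ->
    gu AX (x, y, z, t) = 0 /\ gu AY (x, y, z, t) = 0 /\ gu AZ (x, y, z, t) = 0 /\
    gw AZ (x, y, z, t) = 0.
Proof.
intros HF Hk Hb [M HM] Hz0.
assert (G := fun q => rigid_gradients _ _ _ _ _ _ _ _ _ _ _ _ _ _ _ _ _ _ _ _ _ _ q HF Hk Hb).
destruct HF as [HU Ju Jv Jw _ _ _ _ Hd H1 H2 H3].
assert (HB : forall x y t, Rabs (u x y z0 t) <= M /\ Rabs (v x y z0 t) <= M /\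
   Rabs (w x y z0 t) <= M).
{ intros x y t. apply HM. generalize (Hz0 x y t).
  unfold fluid_interior, fluid_domain. lra. }
(* Since [gv AX] vanishes, [- Y3] is the slope of [u] along a y-line. *)
assert (Y3_0 : - Y3 = 0).
{ apply (bounded_slope_zero (fun y => u 0 y z0 0) _ M); [|intros s; apply HB].
  intros s. assert (Hq := Hz0 0 s 0). assert (K := jet_pd1 _ _ _ _ Ju AY (0, s, z0, 0) Hq).
  replace (- Y3) with (gu AY (0, s, z0, 0)); [exact K|].
  rewrite <- (H3 (0, s, z0, 0)) by exact Hq.
  destruct (G (0, s, z0, 0) Hq) as (-> & _). ring. }
assert (Guxx : forall q, uncurry4 (fluid_interior p eta) q -> hu AX AX q = 0).
{ intros q Hq.
  assert (Hvxy : hv AX AY q = 0).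
  { apply (is_pd_eq _ AY (gv AX) (fun _ => 0) q _ _ HU Hq); [intros r Hr; now apply G| |];
    solve_pd. }
  assert (Hvyx := jet_sym _ _ _ _ AX AY q HU Jv Hq).
  (* Incompressibility and [gw AZ = gv AY] give [gu AX = -2 * gv AY]; the summand with factor 0 is
     what the product rule leaves for the constant -2. *)
  assert (E : hu AX AX q = 0 * gv AY q + -2 * hv AY AX q).
  { apply (is_pd_eq _ AX (gu AX) (fun r => -2 * gv AY r) q _ _ HU Hq); try solve_pd.
    intros r Hr. specialize (Hd r Hr). destruct (G r Hr) as (_ & _ & E). lra. }
  rewrite E, <- Hvyx, Hvxy. ring. }
assert (Guxz : forall q, uncurry4 (fluid_interior p eta) q -> hu AX AZ q = 0).
{ intros q Hq. rewrite (jet_sym _ _ _ _ AX AZ q HU Ju Hq).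
  apply (is_pd_eq _ AX (gu AZ) (fun _ => 0) q _ _ HU Hq); [intros r Hr; now apply G| |];
  solve_pd. }
assert (L : forall x y t, gu AX (x, y, z0, t) = gu AX (0, y, z0, t)).
{ intros x y t. rewrite (affine_of_derive (fun s => gu AX (s, y, z0, t)) 0 0 x); [ring|].
  intros s _. rewrite <- (Guxx (s, y, z0, t)) by apply (Hz0 s y t).
  apply (jet_pd2 _ _ _ _ Ju AX AX (s, y, z0, t)), (Hz0 s y t). }
assert (L0 : forall y t, gu AX (0, y, z0, t) = 0).
{ intros y t. apply (bounded_slope_zero (fun x => u x y z0 t) _ M); [|intros s; apply HB].
  intros s. rewrite <- (L s). apply (jet_pd1 _ _ _ _ Ju AX (s, y, z0, t)), (Hz0 s y t). }
assert (Gux : forall x y z t, fluid_interior p eta x y z t -> gu AX (x, y, z, t) = 0).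
{ intros x y z t Hq. rewrite <- (L0 y t), <- (L x y t).
  rewrite (affine_of_derive (fun s => gu AX (x, y, s, t)) 0 z0 z); [ring|].
  intros s Hs.
  assert (Hq' := interior_segment _ _ _ _ _ _ _ _ (Hz0 x y t) Hq Hs).
  rewrite <- (Guxz (x, y, s, t)) by exact Hq'.
  now apply (jet_pd2 _ _ _ _ Ju AX AZ (x, y, s, t)). }
intros x y z t Hq. specialize (Gux x y z t Hq).
destruct (G (x, y, z, t) Hq) as (E1 & E2 & E3).
specialize (Hd (x, y, z, t) Hq); specialize (H3 (x, y, z, t) Hq). lra.
Qed.

(** * Uniqueness of the bounded flow *)

(** Carries interior identities to the bed and the surface, where only continuity is available. *)
Lemma vertical_value (p : params) (eta : R -> R) (f : field) (G : R -> R) (x y t : R) :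
  continuous_on (uncurry4 (fluid_domain p eta)) (uncurry4 f) ->
  (forall s, continuous G s) -> - depth p < eta (x - speed p * t) ->
  (forall z, fluid_interior p eta x y z t -> f x y z t = G z) ->
  forall z, fluid_domain p eta x y z t -> f x y z t = G z.
Proof.
intros Cf CG Hd E.
apply (eq_on_closed_interval (fun z => f x y z t) G); auto.
- exact (continuous_on_vertical p eta f x y t Cf).
- now apply continuous_on_forall.
Qed.

Lemma cor_fhat_pos (p : params) : admissible_params p -> 0 < cor_fhat p.
Proof.
intros (H & _ & _ & _ & _ & _ & _ & Hphi). unfold cor_fhat.
assert (0 < cos (phi p)) by (apply cos_gt_0; lra). nra.
Qed.

Lemma cor_beta_pos (p : params) : admissible_params p -> 0 < cor_beta p.
Proof.
intros H. apply Rdiv_lt_0_compat; [now apply cor_fhat_pos|apply H].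
Qed.

Lemma continuous_linear (k c e s : R) : continuous (fun z => k * (z - c) + e) s.
Proof.
apply continuous_Rplus; [|apply continuous_const].
apply continuous_Rmult; [apply continuous_const|].
apply continuous_Rminus; [apply continuous_id|apply continuous_const].
Qed.

Lemma bounded_solution_unique (p : params) (u v w P : field) (eta : R -> R) (Y1 Y2 Y3 : R) :
  admissible_params p -> solution p u v w P eta -> bounded_velocity p u v w eta ->
  constant_vorticity p u v w eta Y1 Y2 Y3 ->
  exists eta0 : R,
    (forall s, eta s = eta0) /\
    forall x y z t, fluid_domain p eta x y z t ->
      u x y z t = flat_u p x y z t /\ v x y z t = flat_v x y z t /\
      w x y z t = flat_w x y z t /\ P x y z t = flat_P p eta0 x y z t.
Proof.
intros Hadm Hsol Hbd Hvort.
destruct (solution_flow p u v w P eta Y1 Y2 Y3 Hadm Hsol Hvort)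
  as (gu & gv & gw & gP & hu & hv & hw & HF).
destruct Hsol as (Hprof & (Cu & Cv & Cw & CP) & _ & _ & Hdyn & Hkin & Hbed).
apply C_upto_continuous_on in Cu, Cv, Cw, CP.
assert (Hbeta := cor_beta_pos p Hadm).
assert (Hd : forall s, - depth p < eta s) by apply Hprof.
assert (Hrho : 0 < rho p) by apply Hadm.
assert (Hc : 0 < speed p) by apply Hadm.
destruct (level_below_surface p eta Hadm Hprof) as (z0 & Hz0 & Hz0').
assert (I0 : forall x y t, fluid_interior p eta x y z0 t).
{ intros x y t. split; auto. }
assert (Hk : - rho p <> 0) by lra.
assert (Hb : cor_beta p <> 0) by lra.
assert (G := steady_gradients _ _ _ _ _ _ _ _ _ _ _ _ _ _ _ _ _ _ _ _ _ _ _ z0 HF Hk Hb Hbd I0).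
assert (S := fun q => absolute_vorticity_stretching _ _ _ _ _ _ _ _ _ _ _ _ _ _ _ _ _ _ _ _ _ _ q HF Hk).
destruct HF as [HU Ju Jv Jw HP _ Hy Hz _ _ _ _].
(* Along a vertical [w] is constant inside the fluid, and continuity down to the bed equates this
   constant with the bed value 0. *)
assert (Ww : forall x y z t, fluid_interior p eta x y z t -> w x y z t = 0).
{ intros x y z t Hq. rewrite <- (Hbed x y t). symmetry.
  apply (vertical_value p eta w (fun _ => w x y z t) x y t Cw); auto.
  - intros s; apply continuous_const.
  - intros r Hr. rewrite (affine_of_derive (fun s => w x y s t) 0 z r); [ring|].
    intros s Hs. assert (Hq' := interior_segment _ _ _ _ _ _ _ _ Hq Hr Hs).
    destruct (G x y s t Hq') as (_ & _ & _ & E). rewrite <- E.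
    now apply (jet_pd1 _ _ _ _ Jw AZ (x, y, s, t)).
  - specialize (Hd (x - speed p * t)). unfold fluid_domain; lra. }
assert (Gw : forall i q, uncurry4 (fluid_interior p eta) q -> gw i q = 0).
{ intros i q Hq. apply (is_pd_eq _ i (uncurry4 w) (fun _ => 0) q _ _ HU Hq); try solve_pd.
  intros [[[x y] z] t] Hr. now apply Ww. }
assert (Vv : forall q, uncurry4 (fluid_interior p eta) q -> uncurry4 v q = 0).
{ intros q Hq. destruct (S q Hq) as (_ & _ & E). rewrite !Gw in E by exact Hq.
  apply (Rmult_eq_reg_l (cor_beta p)); auto. rewrite <- E. ring. }
assert (Gv : forall i q, uncurry4 (fluid_interior p eta) q -> gv i q = 0).
{ intros i q Hq. apply (is_pd_eq _ i (uncurry4 v) (fun _ => 0) q _ _ HU Hq); try solve_pd.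
  exact Vv. }
(* First move vertically to the plane [z0], then along y within that plane. *)
assert (Uyz : forall x y z t, fluid_interior p eta x y z t -> u x y z t = u x 0 z0 t).
{ intros x y z t Hq.
  rewrite (affine_of_derive (fun s => u x y s t) 0 z0 z).
  - rewrite (affine_of_derive (fun s => u x s z0 t) 0 0 y); [ring|].
    intros s _. destruct (G x s z0 t (I0 x s t)) as (_ & E & _). rewrite <- E.
    apply (jet_pd1 _ _ _ _ Ju AY (x, s, z0, t)), (I0 x s t).
  - intros s Hs. assert (Hq' := interior_segment _ _ _ _ _ _ _ _ (I0 x y t) Hq Hs).
    destruct (G x y s t Hq') as (_ & _ & E & _). rewrite <- E.
    now apply (jet_pd1 _ _ _ _ Ju AZ (x, y, s, t)). }
(* P(x,y,z,t) - P(x,0,z,t) is a quadratic polynomial in y with coefficients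
   independent of z; it vanishes on the surface, hence identically. *)
assert (Py : forall x y t,
  (cor_f p * u x 0 z0 t + cor_fhat p * cor_f p / 4 * radius p) * y +
  (cor_beta p * u x 0 z0 t + cor_fhat p ^ 2 / 4) * (y * y / 2) = 0).
{ intros x y t.
  set (m := u x 0 z0 t). set (k := cor_f p * m + _). set (l := cor_beta p * m + _).
  assert (E : P x y (eta (x - speed p * t)) t =
     P x 0 (eta (x - speed p * t)) t + - rho p * (k * y + l * (y * y / 2))).
  { apply (eq_on_closed_interval (fun z => P x y z t)
      (fun z => P x 0 z t + - rho p * (k * y + l * (y * y / 2)))
      (- depth p) (eta (x - speed p * t))); auto.
    - exact (continuous_on_vertical p eta P x y t CP).
    - intros z Hz'. apply (filterlim_comp _ _ _ (fun z => P x 0 z t)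
        (fun r => r + - rho p * (k * y + l * (y * y / 2))) _ (locally (P x 0 z t)) _).
      + exact (continuous_on_vertical p eta P x 0 t CP z Hz').
      + apply (continuous_Rplus (fun r : R => r) (fun _ => - rho p * (k * y + l * (y * y / 2)))).
        * apply continuous_id.
        * apply continuous_const.
    - intros z Hz'.
      (* The whole y-line at this height is in the fluid, as the surface does not depend on y. Since
         [v] and its gradient vanish, subtracting the polynomial leaves a function with zero
         y-derivative. *)
      assert (A := affine_of_derive
        (fun s => P x s z t - - rho p * (k * s + l * (s * s / 2))) 0 0 y).
      simpl in A. rewrite Rmult_0_l in A. enough (Q : forall s, is_derive
        (fun s => P x s z t - - rho p * (k * s + l * (s * s / 2))) s 0).
      { specialize (A (fun s _ => Q s)). lra. }
      intros s. assert (Hq : uncurry4 (fluid_interior p eta) (x, s, z, t)) by exact Hz'.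
      assert (K := HP AY _ Hq). rewrite (Hy _ Hq) in K. unfold is_pd in K.
      unfold transport in K. rewrite !Gv in K by exact Hq. simpl in K.
      rewrite (Uyz x s z t Hz') in K. fold m in K.
      auto_derive.
      + eexists; exact K.
      + rewrite (is_derive_unique _ _ _ K). unfold k, l. field.
    - specialize (Hd (x - speed p * t)). lra. }
  rewrite !Hdyn in E. nra. }
assert (Um : forall x t, u x 0 z0 t = - (cor_fhat p ^ 2 / (4 * cor_beta p))).
{ intros x t. assert (E1 := Py x 1 t). assert (E2 := Py x (-1) t).
  apply (Rmult_eq_reg_l (cor_beta p)); auto.
  replace (cor_beta p * - (cor_fhat p ^ 2 / (4 * cor_beta p))) with (- (cor_fhat p ^ 2 / 4))
    by (field; auto). lra. }
assert (UD : forall x y z t, fluid_domain p eta x y z t -> u x y z t = flat_u p x y z t).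
{ intros x y z t Hq.
  apply (vertical_value p eta u (fun _ => flat_u p x y z t) x y t Cu); auto.
  - intros s; apply continuous_const.
  - intros r Hr. rewrite (Uyz x y r t Hr). apply Um. }
assert (VD : forall x y z t, fluid_domain p eta x y z t -> v x y z t = 0).
{ intros x y z t Hq.
  apply (vertical_value p eta v (fun _ => 0) x y t Cv); auto.
  - intros s; apply continuous_const.
  - intros r Hr. exact (Vv (x, y, r, t) Hr). }
assert (WD : forall x y z t, fluid_domain p eta x y z t -> w x y z t = 0).
{ intros x y z t Hq.
  apply (vertical_value p eta w (fun _ => 0) x y t Cw); auto.
  intros s; apply continuous_const. }
assert (Heta' : forall s, Derive eta s = 0).
{ intros s. assert (K := Hkin s 0 0). cbv zeta in K.
  assert (Hq : fluid_domain p eta s 0 (eta (s - speed p * 0)) 0).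
  { specialize (Hd (s - speed p * 0)). unfold fluid_domain. lra. }
  rewrite (WD _ _ _ _ Hq), (UD _ _ _ _ Hq) in K. unfold flat_u in K.
  replace (s - speed p * 0) with s in K by ring.
  assert (0 <= cor_fhat p ^ 2 / (4 * cor_beta p)).
  { apply Rmult_le_pos; [apply pow2_ge_0|]. left; apply Rinv_0_lt_compat; lra. }
  symmetry in K. apply Rmult_integral in K. destruct K; lra. }
assert (Heta : forall s, eta s = eta 0).
{ intros s. rewrite (affine_of_derive eta 0 0 s); [ring|].
  intros r _. rewrite <- (Heta' r). apply Derive_correct, Hprof. }
exists (eta 0). split; auto.
intros x y z t Hq. refine (conj (UD _ _ _ _ Hq) (conj (VD _ _ _ _ Hq) (conj (WD _ _ _ _ Hq) _))).
set (k := rho p * (- (cor_fhat p ^ 3 / (4 * cor_beta p)) + cor_fhat p ^ 2 / 4 * radius p - grav p)).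
(* With [w] and its gradient zero, the vertical equation prescribes the constant slope [k]. The line
   is anchored at the interior height [z0]; the surface value is used afterwards to eliminate
   [P x y z0 t]. *)
assert (E : forall z, fluid_domain p eta x y z t -> P x y z t = k * (z - z0) + P x y z0 t).
{ apply (vertical_value p eta P (fun z => k * (z - z0) + P x y z0 t) x y t CP); auto.
  - intros s; apply continuous_linear.
  - intros r Hr. rewrite (affine_of_derive (fun s => P x y s t) k z0 r); [ring|].
    intros s Hs. assert (Hq' := interior_segment _ _ _ _ _ _ _ _ (I0 x y t) Hr Hs).
    assert (K := HP AZ (x, y, s, t) Hq'). rewrite (Hz (x, y, s, t) Hq') in K.
    unfold transport in K. rewrite !Gw in K by exact Hq'. simpl in K.
    rewrite (Uyz x y s t Hq'), Um in K.
    replace k with (- rho p * (0 + u x y s t * 0 + v x y s t * 0 + w x y s t * 0 -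
      cor_fhat p * - (cor_fhat p ^ 2 / (4 * cor_beta p)) -
      (cor_fhat p ^ 2 / 4 * radius p - grav p))) by (unfold k; field; auto).
    rewrite (Uyz x y s t Hq'), Um. exact K. }
assert (E1 := E _ Hq).
assert (Hs : fluid_domain p eta x y (eta (x - speed p * t)) t).
{ specialize (Hd (x - speed p * t)). unfold fluid_domain. lra. }
assert (E2 := E _ Hs). rewrite Hdyn, Heta in E2.
unfold flat_P; fold k. lra.
Qed.

(** * The flat flow is a solution *)

Lemma C_upto_const (n : nat) (U D : region) (k : R) : C_upto n U D (fun _ _ _ _ => k).
Proof.
revert k; induction n; intros k.
- split; [|exact I]. apply continuous_on_forall. intros q _.
  apply (continuous_ext (fun _ => k)); [now intros [[[? ?] ?] ?]|apply continuous_const].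
- split.
  { apply continuous_on_forall. intros q _.
    apply (continuous_ext (fun _ => k)); [now intros [[[? ?] ?] ?]|apply continuous_const]. }
  exists (fun _ _ _ _ => 0), (fun _ _ _ _ => 0), (fun _ _ _ _ => 0), (fun _ _ _ _ => 0).
  split; [auto|]. intros x y z t _.
  refine (conj _ (conj _ (conj _ _)));
    apply (is_derive_const (K := R_AbsRing) (V := R_NormedModule) k).
Qed.

Lemma Derive_const_partials (k x y z t : R) :
  Defs.Dx (fun _ _ _ _ => k) x y z t = 0 /\ Dy (fun _ _ _ _ => k) x y z t = 0 /\
  Dz (fun _ _ _ _ => k) x y z t = 0 /\ Dt (fun _ _ _ _ => k) x y z t = 0.
Proof. repeat split; exact (Derive_const k _). Qed.

Lemma is_derive_linear (k c e z : R) : is_derive (fun s => k * (s - c) + e) z k.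
Proof. auto_derive; [exact I|ring]. Qed.

(** The zero-mean normalization sets the height to 0. In the meridional equation [Hm] cancels the
    terms linear in y, and the constant terms cancel because [cor_fhat p / cor_beta p] is the
    radius. *)
Lemma flat_flow_solution (p : params) :
  admissible_params p -> solution p (flat_u p) flat_v flat_w (flat_P p 0) (fun _ => 0).
Proof.
intros Hadm.
assert (Hbeta := cor_beta_pos p Hadm).
destruct Hadm as (_ & HR & _ & Hrho & Hd & _ & _ & _).
unfold flat_u, flat_v, flat_w, flat_P.
set (m := - (cor_fhat p ^ 2 / (4 * cor_beta p))). set (k := rho p * _).
assert (Hm : cor_beta p * m = - (cor_fhat p ^ 2 / 4)) by (unfold m; field; lra).
refine (conj _ (conj _ (conj _ (conj _ (conj _ (conj _ _)))))).
- refine (conj _ (conj _ (conj _ _))).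
  + intros s. split; [apply ex_derive_const|].
    apply (continuous_ext (fun _ => 0)); [intros r; symmetry; apply Derive_const|].
    apply continuous_const.
  + easy.
  + intros _; lra.
  + rewrite RInt_const. apply Rmult_0_r.
- refine (conj _ (conj _ (conj _ _))); try apply C_upto_const.
  split.
  + apply continuous_on_forall. intros q _.
    apply (continuous_ext (fun q : point => k * (coord AZ q - 0) + Patm p)).
    { now intros [[[x y] z] t]. }
    apply (continuous_comp (coord AZ) (fun z => k * (z - 0) + Patm p));
      [apply continuous_coord|apply continuous_linear].
  + exists (fun _ _ _ _ => 0), (fun _ _ _ _ => 0), (fun _ _ _ _ => k), (fun _ _ _ _ => 0).
    split; [refine (conj _ (conj _ (conj _ _))); exact (C_upto_const 0 _ _ _)|].
    intros x y z t _. refine (conj _ (conj _ (conj _ _)));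
      try apply (is_derive_const (K := R_AbsRing) (V := R_NormedModule)).
    apply is_derive_linear.
- intros x y z t _. cbv zeta.
  destruct (Derive_const_partials m x y z t) as (-> & -> & -> & ->).
  destruct (Derive_const_partials 0 x y z t) as (-> & -> & -> & ->).
  assert (Px : Defs.Dx (fun _ _ z _ => k * (z - 0) + Patm p) x y z t = 0)
    by exact (Derive_const (k * (z - 0) + Patm p) _).
  assert (Py : Dy (fun _ _ z _ => k * (z - 0) + Patm p) x y z t = 0)
    by exact (Derive_const (k * (z - 0) + Patm p) _).
  assert (Pz : Dz (fun _ _ z _ => k * (z - 0) + Patm p) x y z t = k)
    by (apply is_derive_unique, is_derive_linear).
  rewrite Px, Py, Pz. refine (conj _ (conj _ _)).
  + ring.
  + replace ((cor_f p + cor_beta p * y) * m) with (cor_f p * m + y * (cor_beta p * m)) by ring.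
    rewrite Hm. unfold m, cor_beta. unfold cor_beta in Hbeta.
    assert (cor_fhat p <> 0).
    { intros E. rewrite E in Hbeta. unfold Rdiv in Hbeta. lra. }
    field; repeat split; lra.
  + unfold k, m. field. lra.
- intros x y z t _.
  destruct (Derive_const_partials m x y z t) as (-> & _).
  destruct (Derive_const_partials 0 x y z t) as (_ & -> & -> & _). ring.
- intros x y t. ring.
- intros x y t. cbv zeta. rewrite Derive_const. ring.
- easy.
Qed.

Theorem theorem4p2 (p : params) (hp : admissible_params p) :
  (forall (Y1 Y2 Y3 : R) (u v w P : field) (eta : R -> R),
     solution p u v w P eta ->
     bounded_velocity p u v w eta ->
     constant_vorticity p u v w eta Y1 Y2 Y3 ->
     Y2 + cor_fhat p <> 0 ->
     exists eta0 : R,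
       (forall s, eta s = eta0) /\
       forall x y z t, fluid_domain p eta x y z t ->
         u x y z t = flat_u p x y z t /\
         v x y z t = flat_v x y z t /\
         w x y z t = flat_w x y z t /\
         P x y z t = flat_P p eta0 x y z t)
  /\
  (exists eta0 Y1 Y2 Y3 : R,
     let eta := fun _ : R => eta0 in
     solution p (flat_u p) flat_v flat_w (flat_P p eta0) eta /\
     bounded_velocity p (flat_u p) flat_v flat_w eta /\
     constant_vorticity p (flat_u p) flat_v flat_w eta Y1 Y2 Y3 /\
     Y2 + cor_fhat p <> 0).
Proof.
split.
- intros Y1 Y2 Y3 u v w P eta Hsol Hbd Hvort _.
  exact (bounded_solution_unique p u v w P eta Y1 Y2 Y3 hp Hsol Hbd Hvort).
(* A uniform velocity has zero vorticity, so the nondegeneracy condition reduces to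
   [cor_fhat p <> 0]. *)
- exists 0, 0, 0, 0. refine (conj (flat_flow_solution p hp) (conj _ (conj _ _))).
  + exists (Rabs (cor_fhat p ^ 2 / (4 * cor_beta p))). intros x y z t _.
    unfold flat_u, flat_v, flat_w. rewrite Rabs_Ropp, Rabs_R0.
    assert (H := Rabs_pos (cor_fhat p ^ 2 / (4 * cor_beta p))). lra.
  + intros x y z t _.
    destruct (Derive_const_partials (- (cor_fhat p ^ 2 / (4 * cor_beta p))) x y z t)
      as (_ & Uy & Uz & _).
    destruct (Derive_const_partials 0 x y z t) as (Zx & Zy & Zz & _).
    unfold flat_u, flat_v, flat_w. rewrite Uy, Uz, Zx, Zy, Zz. lra.
  + assert (H := cor_fhat_pos p hp). lra.
Qed.
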